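(* Let $\Pi(x,y)$, $x,y\in\mathbb{Z}$, be a kernel yielding an operator of orthogonal projection acting in $L_2(\mathbb{Z})$. Assume that there exist $\alpha\in(0,1/2)$, $\varepsilon>0$, and, for any $R>0$, a constant $C(R)>0$ such that the following holds: (1) for all $x,y\in\mathbb{Z}$ with $x\neq y$ and $|x|,|y|\ge R$, $$|\Pi(x,y)|\le C(R)\cdot\frac{|x/y|^{\alpha}+|y/x|^{\alpha}}{|x-y|};$$ (2) for all $y\in\mathbb{Z}$, $$\sum_{x\in\mathbb{Z}:\,|x|\le R}|\Pi(x,y)|^2\le\frac{C(R)}{1+|y|^{1+\varepsilon}}.$$ Then the determinantal point process $\mathbb{P}_\Pi$ on $\mathbb{Z}$ is rigid.
   Context: $L_2(\mathbb{Z})$ is taken with respect to counting measure. Let $M$ be a complete separable metric space (here $M=\mathbb{Z}$ with the metric of $\mathbb{R}$, so bounded sets are finite). A configuration on $M$ is a collection of particles in $M$, considered without regard to order and without accumulation points (a purely atomic Radon measure); $\mathrm{Conf}(M)$ is the space of configurations with the vague topology, and a point process on $M$ is a Borel probability measure on $\mathrm{Conf}(M)$. For a bounded Borel set $B\subset M$ and $X\in\mathrm{Conf}(M)$, $\#_B(X)$ is the number of particles of $X$ in $B$. For Borel $C\subset M$, $\mathcal{F}_C$ is the $\sigma$-algebra generated by all $\#_B$ with $B\subset C$ bounded Borel, and $\mathcal{F}_C^{\mathbb{P}}$ is its $\mathbb{P}$-completion. A point process $\mathbb{P}$ on $M$ is called rigid if for every bounded Borel $B\subset M$ the random variable $\#_B$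 is $\mathcal{F}^{\mathbb{P}}_{M\setminus B}$-measurable. For the kernel $\Pi(x,y)$ of a locally trace-class orthogonal projection in $L_2(M,\mu)$, the determinantal point process $\mathbb{P}_\Pi$ is the unique Borel probability measure on $\mathrm{Conf}(M)$ such that for any bounded measurable $g$ with $g-1$ supported in a bounded set $B$, $\mathbb{E}_{\mathbb{P}_\Pi}\Psi_g=\det(1+(g-1)\Pi\chi_B)$, where $\Psi_g(X)=\prod_{x\in X}g(x)$ and $\chi_B$ is the indicator of $B$. *)

(* Defs.v *)
From HB Require Import structures.
From mathcomp Require Import all_boot all_order all_algebra.
From mathcomp Require Import finmap.
From mathcomp Require Import all_classical all_reals all_analysis.
From mathcomp Require Import complex.

Set Implicit Arguments.
Unset Strict Implicit.
Unset Printing Implicit Defensive.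

Import Order.TTheory GRing.Theory Num.Theory.
Import numFieldNormedType.Exports.
Import ComplexField.Normc.

Local Open Scope classical_set_scope.
Local Open Scope ring_scope.

(* The discrete sigma-algebra on the integers, so that [counting] is a measure
   on [int]. *)
HB.instance Definition _ := isPointed.Build int 0.
HB.instance Definition _ := @isMeasurable.Build default_measure_display
  int discrete_measurable discrete_measurable0
  discrete_measurableC discrete_measurableU.

Definition bounded_subset (B : set int) : Prop :=
  exists r : int, forall x, B x -> `|x| <= r.

Section projection_kernels.
Context {R : realType}.
Implicit Types (f g : int -> R[i]) (K : int -> int -> R[i]).

Definition zsummable f : Prop :=
  counting.-integrable [set: int] (fun x => (normc (f x))%:E : \bar R).

(* Only meaningful for [zsummable f]. *)
Definition zsum f : R[i] :=
  Complex (\int[counting]_(x in [set: int]) complex.Re (f x))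
          (\int[counting]_(x in [set: int]) complex.Im (f x)).

Definition in_L2 f : Prop :=
  (\int[counting]_(x in [set: int]) (normc (f x) ^+ 2)%:E < +oo :> \bar R)%E.

Definition L2_dot f g : R[i] := zsum (fun x => f x * conjc (g x)).

Definition kernel_op K f : int -> R[i] := fun x => zsum (fun y => K x y * f y).

(* [kernel_op K] is a well-defined, everywhere defined operator on L_2(Z) that
   is idempotent and self-adjoint; linearity is automatic, and boundedness
   follows from |Kf|^2 = (Kf, f). *)
Definition orthogonal_projection_kernel K : Prop :=
  [/\ forall f, in_L2 f -> forall x, zsummable (fun y => K x y * f y),
      forall f, in_L2 f -> in_L2 (kernel_op K f),
      forall f, in_L2 f -> kernel_op K (kernel_op K f) = kernel_op K f
    & forall f g, in_L2 f -> in_L2 g ->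
        L2_dot (kernel_op K f) g = L2_dot f (kernel_op K g)].

End projection_kernels.

(* A purely atomic Radon measure on Z whose atoms are particles is a function
   giving the number of particles at each site (multiple particles are
   allowed); local finiteness is automatic.  The real type [R] only serves to
   provide the test functions of the vague topology. *)
Definition conf (R : realType) : Type := int -> nat.

HB.instance Definition _ (R : realType) :=
  Pointed.copy (conf R) (int -> nat).

Section vague_topology.
Context (R : realType).

(* The integral of [f] against the measure [X]. *)
Definition conf_integral (f : int -> R) (X : conf R) : R :=
  \sum_(x \in [set: int]) f x *+ X x.

(* The vague topology is the coarsest one for which [conf_integral f] is
   continuous for every (continuous) compactly supported [f]. *)
Definition vague_index : set ((int -> R) * set R) :=
  [set fU | bounded_subset (fU.1 @^-1` [set~ 0]) /\ open fU.2].

Definition vague_subbase (fU : (int -> R) * set R) : set (conf R) :=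
  conf_integral fU.1 @^-1` fU.2.

HB.instance Definition _ :=
  @isSubBaseTopological.Build (conf R) _ vague_index vague_subbase.

Definition borel_conf := g_sigma_algebraType (@open (conf R)).

End vague_topology.

Section point_processes.
Context {R : realType}.

(* Meaningful for bounded, hence finite, [B]. *)
Definition num_particles (B : set int) (X : conf R) : nat :=
  \big[addn/0%N]_(x \in B) X x.

Definition particle_events (C : set int) : set (set (conf R)) :=
  [set A | exists B K, [/\ bounded_subset B, B `<=` C
                         & A = num_particles B @^-1` K]].

(* The completion adjoins all P-null sets of Conf(Z), not only those contained
   in a P-null event of <<s particle_events C>>: with the latter no process
   would be rigid, since changing a configuration inside B leaves the events
   of Z \ B unaffected. *)
Definition completed_sigma (P : probability (borel_conf R) R) (C : set int) :=
  g_sigma_algebraType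
    (<<s particle_events C >> `|` P.-negligible : set (set (conf R))).

Definition rigid (P : probability (borel_conf R) R) : Prop :=
  forall B : set int, bounded_subset B ->
    measurable_fun setT (num_particles B : completed_sigma P (~` B) -> nat).

(* [Psi g X] is the product of [g] over the particles of [X], counted with
   multiplicity; the product is finite as soon as [g = 1] off a finite set. *)
Definition Psi (g : int -> R[i]) (X : conf R) : R[i] :=
  \big[*%R/1]_(x \in [set: int]) g x ^+ X x.

(* The determinant det(1 + (g - 1) K chi_B) for [g = 1] off the finite set [B]:
   the operator (g - 1) K chi_B vanishes off L_2(B) and has range in L_2(B), so
   its Fredholm determinant is that of its matrix in the basis of the
   indicators of the points of [B]. *)
Definition fredholm_det (K : int -> int -> R[i]) (g : int -> R[i])
    (B : set int) : R[i] :=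
  let s : seq int := fset_set B in
  \det (1%:M + \matrix_(i < size s, j < size s)
                 ((g s`_i - 1) * K s`_i s`_j)).

(* A complex expectation is given by its real and imaginary parts; as the
   values are finite, these equalities also assert that [Psi g] is
   integrable.  Functions with [g = 1] off a bounded set are bounded. *)
Definition determinantal (K : int -> int -> R[i])
    (P : probability (borel_conf R) R) : Prop :=
  forall (B : set int) (g : int -> R[i]),
    bounded_subset B -> (forall x, ~ B x -> g x = 1) ->
    ('E_P[fun X => complex.Re (Psi g X)] =
       (complex.Re (fredholm_det K g B))%:E)%E /\
    ('E_P[fun X => complex.Im (Psi g X)] =
       (complex.Im (fredholm_det K g B))%:E)%E.

End point_processes.

(* Main.v *)
Require Import Defs.
From mathcomp Require Import all_boot all_order all_algebra.
From mathcomp Require Import all_classical all_reals all_analysis.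
From mathcomp Require Import measurable_realfun.
From mathcomp Require Import complex.
From mathcomp Require Import ring lra zify.

Set Implicit Arguments.
Unset Strict Implicit.
Unset Printing Implicit Defensive.

Import Order.TTheory GRing.Theory Num.Theory.
Import numFieldNormedType.Exports.
Import ComplexField.Normc.

Local Open Scope classical_set_scope.
Local Open Scope ring_scope.

(** Write p x = Pi x x and w x y = |Pi x y|^2.  The occupation numbers of two
    sites x, y have covariance [x = y] p x - w x y, and because Pi is an
    orthogonal projection, p x is the sum of w x y over y.  The covariance is
    therefore a graph Laplacian: the variance of the linear statistic
    S_f = sum_x f x X x with f finitely supported is the Dirichlet energy
    (1/2) sum_(x,y) (f x - f y)^2 w x y ([energy_dirichlet],
    [has_mean_statistic2]).

    Suppose that functions equal to 1 on a given bounded set B can have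
    arbitrarily small energy.  By Chebyshev and Borel-Cantelli there is then a
    sequence f_j of them with S_(f_j) - E S_(f_j) tending to 0 almost surely.
    Off B the statistic is a function of the exterior configuration, on B it is
    the number of particles in B; hence this number is almost surely determined
    by the exterior ([rigidity_of_small_energy]).

    To produce such functions, it is enough to have functions of bounded energy
    which are constant on larger and larger windows ([exists_small_energy]).
    The Laplacian kills constants, so a fixed function and a far trapezoid have
    energy product close to 0; the average of J trapezoids, each chosen far
    beyond the previous ones, then has energy O(1/J).

    That the trapezoids of slope 1/n have bounded energy
    ([trapezoid_energy_bounded]) is a computation with the off-diagonal bound:
    (f x - f y)^2 w x y is at most a constant times s x * s y, where
    s x = n^(-1) t^(-2 alpha) for t = |x| / (4 n) <= 1 and
    s x = n^(-1) t^(2 alpha - 2) for t > 1 up to constants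
    ([profile_dominates]); as 0 < 2 alpha < 1, the sum of s is bounded
    independently of n ([sum_profile_le]). *)

(** * Sums over symmetric windows of the integers *)

(** The window {-N, ..., N}, built outwards from 0 so that sums over it can be
    handled by induction on N. *)
Fixpoint window (N : nat) : seq int :=
  if N is N'.+1 then [:: N'.+1%:Z, - N'.+1%:Z & window N'] else [:: 0].

Lemma mem_window N (x : int) : (x \in window N) = (`|x|%N <= N)%N.
Proof.
elim: N x => [|N IH] x /=; first by rewrite inE; lia.
rewrite !inE IH; lia.
Qed.

Lemma window_uniq N : uniq (window N).
Proof.
elim: N => // N IH; rewrite [window _]/= !cons_uniq IH !inE !mem_window; lia.
Qed.

Lemma sum_window_widen (V : nmodType) (F : int -> V) M N : (M <= N)%N ->
  (forall x, (M < `|x|)%N -> F x = 0) ->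
  \sum_(x <- window N) F x = \sum_(x <- window M) F x.
Proof.
move=> MN F0; elim: N MN => [|N IH]; first by rewrite leqn0 => /eqP ->.
rewrite leq_eqVlt => /predU1P[-> //|MN] /=.
by rewrite !big_cons !F0 ?add0r ?IH //; lia.
Qed.

Lemma sum_window_le (R : realType) (F : int -> R) M N : (M <= N)%N ->
  (forall x, 0 <= F x) ->
  \sum_(x <- window M) F x <= \sum_(x <- window N) F x.
Proof.
move=> MN F0; elim: N MN => [|N IH]; first by rewrite leqn0 => /eqP ->.
rewrite leq_eqVlt => /predU1P[-> //|MN] /=.
by rewrite !big_cons (le_trans (IH _))// addrA lerDr addr_ge0.
Qed.

Section counting_integral.
Context {R : realType}.

Lemma counting_set1 (z : int) : counting [set z] = 1%:E :> \bar R.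
Proof. by rewrite /counting asboolT//= fset_set1 finmap.cardfs1. Qed.

Lemma integral_counting_set1 (f : int -> \bar R) (z : int) :
  (\int[counting]_(x in [set z]) f x = f z)%E.
Proof.
rewrite (eq_integral (cst (f z))); last by move=> x /set_mem/= ->.
by rewrite integral_cst//= counting_set1 mule1.
Qed.

Lemma integral_counting_support1 (f : int -> \bar R) (z : int) :
  (forall x, x != z -> f x = 0%E) ->
  (\int[counting]_(x in [set: int]) f x = f z)%E.
Proof.
move=> f0; rewrite -integral_counting_set1 [RHS]integral_mkcond.
apply: eq_integral => x _; rewrite patchE; case: ifPn => // /negP xz.
by apply: f0; apply/eqP => xE; apply: xz; rewrite xE inE.
Qed.

Lemma integral_counting_seq (f : int -> \bar R) (s : seq int) :
  uniq s -> (forall x, 0 <= f x)%E ->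
  (\int[counting]_(x in [set` s]) f x = \sum_(x <- s) f x)%E.
Proof.
move=> + f0; elim: s => [|z s IH]; first by rewrite set_nil integral_set0 big_nil.
have -> : [set` z :: s] = [set z] `|` [set` s].
  apply/seteqP; split => x /=; rewrite inE; first by case/predU1P; [left|right].
  by case=> [->|->]; rewrite ?eqxx ?orbT.
rewrite big_cons cons_uniq => /andP[zs us].
rewrite ge0_integral_setU//=; last first.
  rewrite disj_set2E; apply/eqP/seteqP; split => // x [/= ->].
  by rewrite (negbTE zs).
by rewrite IH// integral_counting_set1.
Qed.

Lemma integral_counting_window (f : int -> R) : (forall x, 0 <= f x) ->
  (\sum_(x <- window N) f x)%:E @[N --> \oo] -->
    (\int[counting]_(x in [set: int]) (f x)%:E)%E.
Proof.
move=> f0; have -> : [set: int] = \bigcup_N [set` window N].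
  by apply/seteqP; split => // x _; exists `|x|%N => //=; rewrite mem_window.
under eq_cvg => N do rewrite -sumEFin -integral_counting_seq ?window_uniq//.
apply: ge0_nondecreasing_set_cvg_integral => //.
move=> M N MN; apply/subsetPset => x /=; rewrite !mem_window => xM.
  exact: leq_trans MN.
by move=> N x _; rewrite lee_fin.
Qed.

End counting_integral.

(** * Projection kernels *)

Section projection_kernel.
Context {R : realType}.
Implicit Types K : int -> int -> R[i].

Definition sqnorm_kernel K (x y : int) : R := normc (K x y) ^+ 2.

Definition density K (x : int) : R := complex.Re (K x x).

Lemma sqnorm_kernel_ge0 K x y : 0 <= sqnorm_kernel K x y.
Proof. exact: sqr_ge0. Qed.

Lemma sqr_normcE (z : R[i]) :
  normc z ^+ 2 = complex.Re z ^+ 2 + complex.Im z ^+ 2.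
Proof. by case: z => a b /=; rewrite sqr_sqrtr// addr_ge0// sqr_ge0. Qed.

Definition delta (z x : int) : R[i] := (x == z)%:R.

Lemma zsum_support1 (f : int -> R[i]) z : (forall x, x != z -> f x = 0) ->
  zsum f = f z.
Proof.
move=> f0; rewrite /zsum /Rintegral.
rewrite !(@integral_counting_support1 _ _ z)/=; first by case: (f z).
- by move=> x /f0 ->.
- by move=> x /f0 ->.
Qed.

Lemma in_L2_delta z : in_L2 (delta z).
Proof.
rewrite /in_L2 (@integral_counting_support1 _ _ z) ?ltry// => x xz.
by rewrite /delta (negbTE xz) normc0 expr0n.
Qed.

Lemma kernel_op_delta K z : kernel_op K (delta z) = K^~ z.
Proof.
apply/funext => x; rewrite /kernel_op (@zsum_support1 _ z) /delta ?eqxx ?mulr1//.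
by move=> y yz; rewrite (negbTE yz) mulr0.
Qed.

Section orthogonal_projection.
Context (K : int -> int -> R[i]) (K_proj : orthogonal_projection_kernel K).

(** Self-adjointness, tested on two indicators of points. *)
Lemma kernel_hermitian x y : K y x = conjc (K x y).
Proof.
case: K_proj => _ _ _ /(_ _ _ (in_L2_delta x) (in_L2_delta y)).
rewrite /L2_dot !kernel_op_delta (@zsum_support1 _ y); last first.
  by move=> z zy; rewrite /delta (negbTE zy) conjc0 mulr0.
rewrite (@zsum_support1 _ x); last first.
  by move=> z zx; rewrite /delta (negbTE zx) mul0r.
by rewrite /delta !eqxx conjc1 mulr1 mul1r.
Qed.

Lemma sqnorm_kernel_sym x y : sqnorm_kernel K x y = sqnorm_kernel K y x.
Proof.
rewrite /sqnorm_kernel !sqr_normcE (kernel_hermitian x y).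
by case: (K x y) => a b /=; rewrite sqrrN.
Qed.

Lemma density_real x : K x x = Complex (density K x) 0.
Proof.
have := kernel_hermitian x x; rewrite /density; case: (K x x) => a b /= [] /eqP.
by rewrite -addr_eq0 -mulr2n mulrn_eq0 => /eqP ->.
Qed.

Lemma mul_kernel_sym x y : K x y * K y x = Complex (sqnorm_kernel K x y) 0.
Proof.
rewrite (kernel_hermitian x y) /sqnorm_kernel sqr_normcE; case: (K x y) => a b /=.
by apply/eqP; rewrite eq_complex /=; apply/andP; split; apply/eqP; ring.
Qed.

(** Idempotence, tested on the indicator of x and evaluated at x: the kernel of
    the square is w summed along a row. *)
Lemma row_sum_cvg x :
  \sum_(y <- window N) sqnorm_kernel K x y @[N --> \oo] --> density K x.
Proof.
case: K_proj => sK L2K /(_ _ (in_L2_delta x)) idK _.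
have L2x := L2K _ (in_L2_delta x).
have := sK _ L2x x; rewrite kernel_op_delta => sx.
move: idK; rewrite kernel_op_delta => /(congr1 (fun f => complex.Re (f x))).
rewrite {1}/kernel_op /zsum /= -/(density K x) => <-.
have wE y : complex.Re (K x y * K y x) = sqnorm_kernel K x y.
  by rewrite mul_kernel_sym.
rewrite /Rintegral; under eq_integral do rewrite wE.
have fin_w : (\int[counting]_(y in [set: int]) (sqnorm_kernel K x y)%:E)%E
    \is a fin_num.
  rewrite (_ : (\int[counting]_(y in _) _)%E =
    (\int[counting]_(y in [set: int]) (normc (K x y * K y x))%:E)%E).
    exact: integrable_fin_num.
  apply: eq_integral => y _; rewrite mul_kernel_sym /= expr0n/= addr0.
  by rewrite sqrtr_sqr ger0_norm// sqnorm_kernel_ge0.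
have := integral_counting_window (sqnorm_kernel_ge0 K x).
by rewrite -(fineK fin_w) => /fine_cvg.
Qed.

Lemma row_sum_le x N : \sum_(y <- window N) sqnorm_kernel K x y <= density K x.
Proof.
have /cvg_lim <- // := @row_sum_cvg x.
apply: nondecreasing_cvgn_le; last by apply: cvgP (@row_sum_cvg x).
by move=> M M' MM'; exact: sum_window_le (sqnorm_kernel_ge0 K x).
Qed.

End orthogonal_projection.
End projection_kernel.

(** * Power sums *)

Section power_sums.
Context {R : realType}.

(** Bernoulli's inequality, as Young's inequality for the product of
    (1 - t)^b and 1 with exponents 1/b and 1/(1-b). *)
Lemma powR_bernoulli (b t : R) : 0 < b < 1 -> 0 <= t <= 1 ->
  (1 - t) `^ b <= 1 - b * t.
Proof.
move=> /andP[b0 b1] /andP[t0 t1].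
have := @conjugate_powR R ((1 - t) `^ b) 1 b^-1 (1 - b)^-1 (powR_ge0 _ _) ler01.
rewrite !invr_gt0 !invrK mulr1 powR1 mul1r -powRrM divff ?gt_eqF//.
rewrite powRr1 ?subr_ge0//.
move=> /(_ b0); rewrite subr_gt0 => /(_ b1) h.
by apply: le_trans (h _) _; lra.
Qed.

(** The increment of k^b is at least its derivative b k^(b-1) at the right
    end, by concavity. *)
Lemma powR_increment (b : R) (k : nat) : 0 < b < 1 ->
  b * (k.+1%:R `^ b / k.+1%:R) <= k.+1%:R `^ b - k%:R `^ b.
Proof.
move=> b01; set K : R := k.+1%:R; have K0 : 0 < K by rewrite ltr0n.
have -> : k%:R = K * (1 - K^-1).
  by rewrite mulrBr mulr1 divff ?gt_eqF// /K -natr1 addrK.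
have t01 : 0 <= K^-1 <= 1.
  by rewrite invr_ge0 (ltW K0) /= invf_le1// ler1n.
rewrite powRM ?subr_ge0 ?(ltW K0)//; last by case/andP: t01.
rewrite [leLHS](_ : _ = K `^ b - K `^ b * (1 - b * K^-1)); last by ring.
by rewrite lerB// ler_wpM2l ?powR_ge0// powR_bernoulli.
Qed.

(** The counterpart for k^(-b), deduced from [powR_increment] by taking
    inverses. *)
Lemma powR_decrement (b : R) (k : nat) : 0 < b < 1 -> (0 < k)%N ->
  b / (k.+1%:R `^ b * k.+1%:R) <= (k%:R `^ b)^-1 - (k.+1%:R `^ b)^-1.
Proof.
move=> b01 k0; have := powR_increment k b01.
have : 0 < (k.+1%:R : R) by rewrite ltr0n.
have : 0 < (k.+1%:R : R) `^ b by rewrite powR_gt0// ltr0n.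
have : 0 < (k%:R : R) `^ b by rewrite powR_gt0// ltr0n.
move: (k.+1%:R : R) => K; move: (K `^ b) (k%:R `^ b) => U V V0 U0 K0 h.
have -> : V^-1 - U^-1 = (U - V) / (U * V) by field; rewrite !gt_eqF//.
have -> : b / (U * K) = b * (U / K) / (U * U) by field; rewrite !gt_eqF//.
have bU : 0 <= b * (U / K) by case/andP: b01 => *; rewrite mulr_ge0 ?divr_ge0 ?ltW.
have VU : V <= U by lra.
apply: ler_pM => //.
- by rewrite invr_ge0 mulr_ge0// ltW.
- by rewrite lef_pV2 ?posrE ?mulr_gt0// ler_pM2l.
Qed.

End power_sums.

(** * A summable profile dominating the kernel *)

Section profile.
Context {R : realType} (a : R) (a01 : 0 < a < 1).

(** With t = |x| / m this is m^(-1) t^(-a) for t <= 1 and m^(-1) t^(a-2) for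
    t > 1.  Both powers are summable on their range, and the product of the two
    branches at x (far) and y (near) is |x / y|^a / x^2, which is the decay of
    the kernel between far and near points. *)
Definition profile (m : nat) (x : int) : R :=
  let k : R := `|x|%N%:R in
  if (`|x|%N <= m)%N then (m%:R `^ (1 - a) * k `^ a)^-1
  else m%:R `^ (1 - a) * k `^ a / k ^+ 2.

Lemma profile_ge0 m x : 0 <= profile m x.
Proof.
rewrite /profile; case: ifP => _.
  by rewrite invr_ge0 mulr_ge0// powR_ge0.
by rewrite divr_ge0 ?sqr_ge0// mulr_ge0// powR_ge0.
Qed.

Lemma powRC (k : R) : 0 < k -> k `^ (1 - a) * k `^ a = k.
Proof. by move=> k0; rewrite -powRD ?subrK ?powRr1 ?ltW// implybE gt_eqF ?orbT. Qed.

Let b01 : 0 < 1 - a < 1.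
Proof. by case/andP: a01 => *; apply/andP; split; lra. Qed.

Lemma profile_near (m : nat) (x : int) : (0 < `|x|)%N -> (`|x|%N <= m)%N ->
  profile m x = (m%:R `^ (1 - a))^-1 * (`|x|%N%:R `^ (1 - a) / `|x|%N%:R).
Proof.
rewrite /profile => x0 ->; have k0 : 0 < (`|x|%N%:R : R) by rewrite ltr0n.
rewrite -[in X in _ / X](powRC k0) [in RHS]invfM mulrA mulrA.
by rewrite mulfK ?gt_eqF ?powR_gt0// invfM.
Qed.

Lemma profile_far (m : nat) (x : int) : (m < `|x|)%N ->
  profile m x = m%:R `^ (1 - a) / (`|x|%N%:R `^ (1 - a) * `|x|%N%:R).
Proof.
rewrite /profile => mx; rewrite leqNgt mx /=.
have k0 : 0 < (`|x|%N%:R : R) by rewrite ltr0n (leq_trans _ mx).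
have := powRC k0; have : 0 < (`|x|%N%:R : R) `^ a by rewrite powR_gt0.
have : 0 < (`|x|%N%:R : R) `^ (1 - a) by rewrite powR_gt0.
move: (`|x|%N%:R : R) k0 (m%:R `^ _) => k k0 M.
move: (k `^ _) (k `^ _) => U V U0 V0 <-; field.
by rewrite !gt_eqF.
Qed.

Lemma profile0 m : profile m 0 = 0.
Proof.
by rewrite /profile /= powR0 ?mulr0 ?invr0// gt_eqF//; case/andP: a01.
Qed.

(** In this form and the next one, the bound telescopes: the increments of
    k^(1-a) and k^(a-1) dominate the two branches of the profile. *)
Lemma sum_profile_near (m N : nat) : (N <= m)%N ->
  \sum_(x <- window N) profile m x <=
  2 / (1 - a) * (N%:R `^ (1 - a) / m%:R `^ (1 - a)).
Proof.
elim: N => [|N IH] Nm.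
  by rewrite big_seq1 profile0 powR0 ?mul0r ?mulr0// gt_eqF//; case/andP: b01.
rewrite /= !big_cons !profile_near// ?absz_nat ?abszN//.
have := IH (ltnW Nm); have := powR_increment N b01.
have M0 : 0 < (m%:R : R) `^ (1 - a).
  by rewrite powR_gt0// ltr0n (leq_trans _ Nm).
have b0 : 0 < 1 - a by case/andP: b01.
move: (\sum_(x <- _) _) (N.+1%:R `^ _ / _) => S T.
move: (N.+1%:R `^ _) (N%:R `^ _) (m%:R `^ _) M0 => V U M M0.
move: (1 - a) b0 => b b0 hT hS.
have cM : 0 <= 2 / b / M by rewrite !divr_ge0 ?ltW.
have := ler_wpM2l cM hT.
have -> : 2 / b / M * (b * T) = 2 * (M^-1 * T) by field; rewrite !gt_eqF.
have -> : 2 / b / M * (V - U) = 2 / b * (V / M) - 2 / b * (U / M).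
  by field; rewrite !gt_eqF.
by move: hS; lra.
Qed.

Lemma sum_profile_far (m N : nat) : (0 < m)%N -> (m <= N)%N ->
  \sum_(x <- window N) profile m x <=
  2 / (1 - a) * (2 - m%:R `^ (1 - a) / N%:R `^ (1 - a)).
Proof.
move=> m0; elim: N => [|N IH]; first by rewrite leqNgt m0.
have b0 : 0 < 1 - a by case/andP: b01.
have M0 : 0 < (m%:R : R) `^ (1 - a) by rewrite powR_gt0// ltr0n.
rewrite leq_eqVlt => /predU1P[<-|mN].
  apply: le_trans (sum_profile_near (leqnn m)) _.
  by rewrite divff ?gt_eqF// mulr1 ler_pMr ?divr_gt0//; lra.
have N0 : (0 < N)%N by rewrite (leq_trans m0).
rewrite [window _]/= !big_cons !profile_far ?absz_nat ?abszN//.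
have := IH mN; have := powR_decrement b01 N0.
have T0 : 0 < N.+1%:R `^ (1 - a) * N.+1%:R :> R.
  by rewrite mulr_gt0 ?powR_gt0 ?ltr0n.
move: (\sum_(x <- _) _) (_ * N.+1%:R) T0 => S T T0 hT hS.
have := ler_wpM2l (ltW M0) hT.
have c0 : 0 <= 2 / (1 - a) by rewrite divr_ge0// ltW.
move=> /(ler_wpM2l c0).
have -> : 2 / (1 - a) * (m%:R `^ (1 - a) * ((1 - a) / T)) =
    2 * (m%:R `^ (1 - a) / T).
  by field; rewrite !gt_eqF.
move: (2 / _) (m%:R `^ _) (N%:R `^ _)^-1 (N.+1%:R `^ _)^-1 hS => c M U V.
by lra.
Qed.

Lemma sum_profile_le (m N : nat) : (0 < m)%N ->
  \sum_(x <- window N) profile m x <= 4 / (1 - a).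
Proof.
move=> m0; have b0 : 0 < 1 - a by case/andP: b01.
apply: (@le_trans _ _ (\sum_(x <- window (maxn m N)) profile m x)).
  by apply: sum_window_le (profile_ge0 m); rewrite leq_maxr.
apply: le_trans (sum_profile_far m0 (leq_maxl _ _)) _.
rewrite (_ : 4 / (1 - a) = 2 / (1 - a) * 2); last by ring.
apply: ler_wpM2l; first by rewrite divr_ge0// ltW.
by rewrite gerBl divr_ge0// powR_ge0.
Qed.

(** Here d stands for the difference of the values at x and y of a function
    with slope 1/n and oscillation 1, supported in |x| <= 2n.  If both points
    lie within 4n, the slope beats the factor (x - y)^(-2); otherwise x - y is
    comparable to x and the oscillation is enough. *)
Lemma profile_dominates (n : nat) (x y : int) (d : R) :
  (0 < n)%N -> (0 < `|y|)%N -> (`|y| <= `|x|)%N -> (`|y| <= n.*2)%N ->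
  0 <= d <= 1 -> d <= `|(x - y)%:~R| / n%:R ->
  d ^+ 2 * ((`|x|%N%:R `^ a / `|y|%N%:R `^ a + `|y|%N%:R `^ a / `|x|%N%:R `^ a)
    / (x - y)%:~R ^+ 2) <= 32 * (profile n.*2.*2 x * profile n.*2.*2 y).
Proof.
move=> n0 y0 yx yn /andP[d0 d1] dz.
have x0 := leq_trans y0 yx; have m0 : (0 < n.*2.*2)%N by rewrite !double_gt0.
have X0 : 0 < `|x|%N%:R :> R by rewrite ltr0n.
have nR : 0 < n%:R :> R by rewrite ltr0n.
have QY : 0 < `|y|%N%:R `^ a :> R by rewrite powR_gt0// ltr0n.
have QX : 0 < `|x|%N%:R `^ a :> R by rewrite powR_gt0// ltr0n.
have a0 : 0 <= a by case/andP: a01 => /ltW.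
have QYX : `|y|%N%:R `^ a <= `|x|%N%:R `^ a :> R.
  by rewrite ge0_ler_powR// ?nnegrE ?ler0n// ler_nat.
have P0 : 0 < n.*2.*2%:R `^ (1 - a) :> R by rewrite powR_gt0// ltr0n.
have rE : `|x|%N%:R `^ a / `|y|%N%:R `^ a + `|y|%N%:R `^ a / `|x|%N%:R `^ a
    <= 2 * (`|x|%N%:R `^ a / `|y|%N%:R `^ a) :> R.
  have : `|y|%N%:R `^ a / `|x|%N%:R `^ a <= `|x|%N%:R `^ a / `|y|%N%:R `^ a :> R.
    by apply: ler_pM; rewrite ?invr_ge0 ?(ltW QX) ?(ltW QY)// lef_pV2 ?posrE.
  by move: (_ / _) (_ / _) => u v; lra.
have ym : (`|y| <= n.*2.*2)%N.
  by apply: leq_trans yn _; rewrite -[leqRHS]addnn leq_addr.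
rewrite {2}/profile ym.
have [xm|xm] := leqP `|x|%N n.*2.*2.
  have z2 : d ^+ 2 / (x - y)%:~R ^+ 2 <= (n%:R ^+ 2)^-1.
    have [->|z0] := eqVneq ((x - y)%:~R : R) 0.
      by rewrite expr0n invr0 mulr0 invr_ge0 sqr_ge0.
    rewrite ler_pdivrMr ?exprn_even_gt0// mulrC -expr_div_n.
    rewrite -[leRHS]real_normK ?num_real// ler_sqr ?nnegrE//.
    by rewrite normrM [`|_^-1|]gtr0_norm ?invr_gt0.
  rewrite mulrCA mulrC; apply: le_trans (ler_pM _ _ z2 rE) _.
  - by rewrite divr_ge0// sqr_ge0.
  - by rewrite addr_ge0 ?divr_ge0 ?ltW.
  rewrite /profile xm.
  have Qm : `|x|%N%:R `^ a <= n.*2.*2%:R `^ a :> R.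
    by rewrite ge0_ler_powR// ?nnegrE ?ler0n// ler_nat.
  have : (n.*2.*2%:R : R) `^ (1 - a) * n.*2.*2%:R `^ a = 4 * n%:R.
    by rewrite powRC ?ltr0n// -!muln2 !natrM; ring.
  move: (`|x|%N%:R `^ a) (`|y|%N%:R `^ a) (n.*2.*2%:R `^ _) (n.*2.*2%:R `^ a) n%:R
    QX QY P0 Qm nR => U V P Q N U0 V0 P0 UQ N0 PQ.
  have -> : 32 * ((P * U)^-1 * (P * V)^-1) = 32 / (P ^+ 2 * U * V).
    by field; rewrite !gt_eqF.
  have -> : (N ^+ 2)^-1 * (2 * (U / V)) =
      2 * (P * U) ^+ 2 / (N ^+ 2 * (P ^+ 2 * U * V)).
    by field; rewrite !gt_eqF.
  rewrite ler_pdivrMr ?mulr_gt0 ?exprn_gt0//.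
  rewrite [leRHS](_ : _ = 2 * (4 * N) ^+ 2); last by field; rewrite !gt_eqF.
  rewrite -PQ ler_pM2l// ler_sqr ?nnegrE ?mulr_ge0 ?(ltW P0) ?(ltW U0)//.
    by rewrite ler_pM2l.
  exact: le_trans (ltW U0) UQ.
have z2 : `|x|%N%:R ^+ 2 / 4 <= (x - y)%:~R ^+ 2 :> R.
  rewrite -[leRHS]real_normK ?num_real// (_ : 4 = 2 ^+ 2); last by ring.
  rewrite -expr_div_n ler_sqr ?nnegrE ?divr_ge0// ler_pdivrMr//.
  rewrite -intr_norm [leLHS]pmulrn -[2]/(2%:~R) -intrM ler_int.
  by move: xm yn; clear; lia.
rewrite mulrCA; apply: le_trans (_ : _ <= 2 * (`|x|%N%:R `^ a / `|y|%N%:R `^ a) *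
  (`|x|%N%:R ^+ 2 / 4)^-1) _.
  apply: ler_pM => //.
  - by rewrite divr_ge0// sqr_ge0.
  rewrite -[leRHS]mul1r; apply: ler_pM.
  - exact: sqr_ge0.
  - by rewrite invr_ge0 sqr_ge0.
  - by rewrite expr_le1.
  - have X4 : 0 < `|x|%N%:R ^+ 2 / 4 :> R by rewrite divr_gt0 ?exprn_gt0.
    by rewrite lef_pV2 ?posrE// (lt_le_trans X4).
rewrite /profile leqNgt xm /=.
move: (`|x|%N%:R `^ a) (`|y|%N%:R `^ a) (n.*2.*2%:R `^ _) QX QY P0
  => U V P U0 V0 P0; move: (`|x|%N%:R : R) X0 => X X0.
rewrite [leLHS](_ : _ = 8 * (U / (V * X ^+ 2))); last by field; rewrite !gt_eqF.
rewrite [leRHS](_ : _ = 32 * (U / (V * X ^+ 2))); last by field; rewrite !gt_eqF.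
by rewrite ler_wpM2r ?divr_ge0 ?mulr_ge0 ?sqr_ge0 ?ltW// ltr_nat.
Qed.

End profile.

(** * The energy form *)

Section trapezoid.
Context {R : realType}.

Definition clamp (t : R) : R := Num.min 1 (Num.max 0 t).

Lemma clamp_ge0 t : 0 <= clamp t.
Proof. by rewrite /clamp le_min ler01 le_max lexx. Qed.

Lemma clamp_le1 t : clamp t <= 1.
Proof. by rewrite /clamp ge_min lexx. Qed.

Lemma clamp_lipschitz s t : `|clamp s - clamp t| <= `|s - t|.
Proof.
wlog st : s t / s <= t.
  by move=> h; case/orP: (le_total s t) => /h; rewrite // distrC [leRHS]distrC.
rewrite distrC [leRHS]distrC [leRHS]ger0_norm ?subr_ge0//.
rewrite ger0_norm ?subr_ge0; rewrite /clamp /Num.min /Num.max;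
  by repeat (case: ifPn; rewrite ?ltNge ?negbK); lra.
Qed.

(** The jump of an indicator may cost an energy growing with n; spreading the
    descent over a length n keeps the energy bounded. *)
Definition trapezoid (n : nat) (x : int) : R := clamp (2 - `|x|%N%:R / n%:R).

Lemma trapezoid_ge0 n x : 0 <= trapezoid n x.
Proof. exact: clamp_ge0. Qed.

Lemma trapezoid_le1 n x : trapezoid n x <= 1.
Proof. exact: clamp_le1. Qed.

Lemma trapezoid_one n x : (0 < n)%N -> (`|x| <= n)%N -> trapezoid n x = 1.
Proof.
move=> n0 xn; rewrite /trapezoid /clamp; apply/min_idPl; rewrite le_max.
have : `|x|%N%:R / n%:R <= 1 :> R by rewrite ler_pdivrMr ?ltr0n// mul1r ler_nat.
by move=> xn1; apply/orP; right; lra.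
Qed.

Lemma trapezoid_support n x : (0 < n)%N -> (n.*2 <= `|x|)%N -> trapezoid n x = 0.
Proof.
move=> n0 xn; rewrite /trapezoid /clamp (max_idPl _).
  by rewrite (min_idPr _).
by rewrite subr_le0 ler_pdivlMr ?ltr0n// -natrM ler_nat mul2n.
Qed.

Lemma trapezoid_lipschitz n x y : (0 < n)%N ->
  `|trapezoid n x - trapezoid n y| <= `|(x - y)%:~R| / n%:R.
Proof.
move=> n0; apply: le_trans (clamp_lipschitz _ _) _.
rewrite (_ : _ - _ = (`|y|%N%:R - `|x|%N%:R) / n%:R); last by ring.
rewrite normrM [`|_^-1|]gtr0_norm ?invr_gt0 ?ltr0n// ler_pM2r ?invr_gt0 ?ltr0n//.
rewrite !pmulrn -intrB -!intr_norm ler_int; lia.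
Qed.

Lemma trapezoid_dist_le1 n x y : `|trapezoid n x - trapezoid n y| <= 1.
Proof.
have := trapezoid_ge0 n x; have := trapezoid_ge0 n y.
have := trapezoid_le1 n x; have := trapezoid_le1 n y.
rewrite ler_norml; move: (trapezoid n x) (trapezoid n y) => u v *.
by apply/andP; split; lra.
Qed.

End trapezoid.

Section energy.
Context {R : realType} (w : int -> int -> R) (p : int -> R).
Hypothesis w_ge0 : forall x y, 0 <= w x y.
Hypothesis w_sym : forall x y, w x y = w y x.
Hypothesis w_row_le : forall x N, \sum_(y <- window N) w x y <= p x.
Hypothesis w_row_cvg : forall x,
  \sum_(y <- window N) w x y @[N --> \oo] --> p x.

Definition site_covariance (x y : int) : R := (x == y)%:R * p x - w x y.

Definition energy (N : nat) (f g : int -> R) : R :=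
  \sum_(x <- window N) \sum_(y <- window N) f x * g y * site_covariance x y.

Definition supported (N : nat) (f : int -> R) : Prop :=
  forall x, (N < `|x|)%N -> f x = 0.

Lemma energy_widen M N f g : (M <= N)%N -> supported M f -> supported M g ->
  energy N f g = energy M f g.
Proof.
move=> MN fM gM; rewrite /energy (sum_window_widen MN).
  apply: eq_bigr => x _; apply: sum_window_widen => // y /gM ->.
  by rewrite mulr0 mul0r.
by move=> x /fM -> ; rewrite big1// => y _; rewrite !mul0r.
Qed.

Lemma energy_sym N f g : energy N f g = energy N g f.
Proof.
rewrite /energy exchange_big; apply: eq_bigr => x _; apply: eq_bigr => y _.
rewrite /site_covariance w_sym eq_sym mulrC [f y * _]mulrC [RHS]mulrC; congr (_ * _).
by case: eqP => [->|]; rewrite ?mul0r.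
Qed.

Lemma energyD N f g h : energy N (f \+ g) h = energy N f h + energy N g h.
Proof.
rewrite /energy -big_split; apply: eq_bigr => x _; rewrite -big_split.
by apply: eq_bigr => y _ /=; ring.
Qed.

Lemma energyZ N (c : R) f g : energy N (c \*o f) g = c * energy N f g.
Proof.
rewrite /energy mulr_sumr; apply: eq_bigr => x _; rewrite mulr_sumr.
by apply: eq_bigr => y _ /=; ring.
Qed.

(** The second argument only enters through its image by the Laplacian. *)
Lemma energyE N f g : energy N f g =
  \sum_(x <- window N) f x * (p x * g x - \sum_(y <- window N) w x y * g y).
Proof.
rewrite /energy !big_seq; apply: eq_bigr => x xN.
rewrite mulrBr mulr_sumr.
have -> : f x * (p x * g x) =
    \sum_(y <- window N) f x * g y * ((x == y)%:R * p x).
  rewrite (bigD1_seq x) ?window_uniq//= eqxx big1 ?mul1r ?addr0; first by ring.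
  by move=> y; rewrite eq_sym => /negbTE ->; rewrite mul0r mulr0.
by rewrite -sumrB; apply: eq_bigr => y _; rewrite /site_covariance; ring.
Qed.

(** Expanding the square gives back the covariance, except that the diagonal
    receives the truncated row sum of w instead of p x; the second term corrects
    for this and vanishes when N tends to infinity with f fixed. *)
Lemma energy_dirichlet N f : energy N f f =
  (\sum_(x <- window N) \sum_(y <- window N) (f x - f y) ^+ 2 * w x y) / 2 +
  \sum_(x <- window N) f x ^+ 2 * (p x - \sum_(y <- window N) w x y).
Proof.
have -> : \sum_(x <- window N) \sum_(y <- window N) (f x - f y) ^+ 2 * w x y =
    (\sum_(x <- window N) f x ^+ 2 * \sum_(y <- window N) w x y) * 2 -
    (\sum_(x <- window N) f x * \sum_(y <- window N) w x y * f y) * 2.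
  have e1 : \sum_(x <- window N) \sum_(y <- window N) f x ^+ 2 * w x y =
      \sum_(x <- window N) f x ^+ 2 * \sum_(y <- window N) w x y.
    by apply: eq_bigr => x _; rewrite mulr_sumr.
  have e2 : \sum_(x <- window N) \sum_(y <- window N) f y ^+ 2 * w x y =
      \sum_(x <- window N) f x ^+ 2 * \sum_(y <- window N) w x y.
    rewrite -e1 exchange_big; apply: eq_bigr => x _; apply: eq_bigr => y _.
    by rewrite w_sym.
  have e3 : \sum_(x <- window N) \sum_(y <- window N) f x * (w x y * f y) =
      \sum_(x <- window N) f x * \sum_(y <- window N) w x y * f y.
    by apply: eq_bigr => x _; rewrite mulr_sumr.
  rewrite [_ * 2]mulrDr mulr1 -{1}e1 -e2 -e3 -big_split/= mulr_suml -sumrB.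
  apply: eq_bigr => x _; rewrite -big_split/= mulr_suml -sumrB.
  by apply: eq_bigr => y _; ring.
rewrite mulrBl !mulfK ?pnatr_eq0// addrAC -big_split energyE /= -sumrB.
by apply: eq_bigr => x _; ring.
Qed.

Lemma cvg_sum_seq (s : seq int) (u : nat -> int -> R) (l : int -> R) :
  (forall x, u N x @[N --> \oo] --> l x) ->
  \sum_(x <- s) u N x @[N --> \oo] --> \sum_(x <- s) l x.
Proof.
move=> ul; elim: s => [|x s IH].
  by rewrite big_nil; under eq_cvg do rewrite big_nil; exact: cvg_cst.
by rewrite big_cons; under eq_cvg do rewrite big_cons; exact: cvgD.
Qed.

Lemma defect_cvg M (c : int -> R) :
  \sum_(x <- window M) c x * (p x - \sum_(y <- window N) w x y)
    @[N --> \oo] --> (0 : R).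
Proof.
rewrite [X in _ --> X](_ : _ = \sum_(x <- window M) c x * (p x - p x)); last first.
  by rewrite big1// => x _; rewrite subrr mulr0.
apply: (@cvg_sum_seq _ (fun N x => c x * (p x - \sum_(y <- window N) w x y))
  (fun x => c x * (p x - p x))) => x.
by apply: cvgM; [exact: cvg_cst|apply: cvgB; [exact: cvg_cst|exact: w_row_cvg]].
Qed.

Lemma energy_le M f (B : R) : supported M f ->
  (forall N, \sum_(x <- window N) \sum_(y <- window N)
               (f x - f y) ^+ 2 * w x y <= 2 * B) ->
  energy M f f <= B.
Proof.
move=> fM fB; rewrite -[leRHS]addr0.
have lim_B : B + \sum_(x <- window M) f x ^+ 2 *
    (p x - \sum_(y <- window N) w x y) @[N --> \oo] --> B + 0.
  by apply: cvgD; [exact: cvg_cst|exact: defect_cvg].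
apply: (cvgr_to_ge lim_B).
exists M => // N /= MN; rewrite -(energy_widen MN)// energy_dirichlet.
rewrite [X in _ + X](sum_window_widen MN); last first.
  by move=> x /fM ->; rewrite expr0n mul0r.
by rewrite lerD2r ler_pdivrMr// mulrC.
Qed.

(** Far trapezoids decouple from any fixed function: the energy form is a
    Laplacian, which annihilates constants, and a trapezoid is constant on a
    large window. *)
Lemma energy_trapezoid_le M N n f : (M <= n)%N -> (n.*2 <= N)%N -> (0 < n)%N ->
  supported M f ->
  `|energy N f (trapezoid n)| <=
  \sum_(x <- window M) `|f x| * (p x - \sum_(y <- window n) w x y).
Proof.
move=> Mn nN n0 fM; have nN' : (n <= N)%N by lia.
rewrite energyE (sum_window_widen (leq_trans Mn nN')); last first.
  by move=> x /fM ->; rewrite mul0r.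
rewrite !big_seq; apply: le_trans (ler_norm_sum _ _ _) _.
apply: ler_sum => x; rewrite mem_window => xM.
rewrite normrM ler_wpM2l// trapezoid_one ?(leq_trans xM)// mulr1.
have le_p : \sum_(y <- window N) w x y * trapezoid n y <= p x.
  apply: le_trans (w_row_le x N); apply: ler_sum => y _.
  by rewrite ler_piMr// trapezoid_le1.
rewrite ger0_norm ?subr_ge0// lerB//.
apply: le_trans (sum_window_le nN' _); last first.
  by move=> y; rewrite mulr_ge0// trapezoid_ge0.
rewrite !big_seq; apply: ler_sum => y; rewrite mem_window => yn.
by rewrite trapezoid_one// mulr1.
Qed.

Section cesaro.
Context (B : R).
Hypothesis trapezoid_energy_le :
  forall n, (0 < n)%N -> energy n.*2 (trapezoid n) (trapezoid n) <= B.

(** Each new trapezoid is chosen so far out that it is almost orthogonal to the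
    sum of the previous ones, whence the energy of a sum of J trapezoids grows
    only linearly in J. *)
Lemma trapezoid_sum (n0 J : nat) : exists N f,
  [/\ supported N f, forall x, (`|x| <= n0)%N -> f x = J%:R
    & energy N f f <= J%:R * (B + 1)].
Proof.
elim: J => [|J [M [f [fM f1 fE]]]].
  exists 0%N, (fun=> 0); split=> //.
  by rewrite /energy big1 ?mul0r// => x _; rewrite big1// => y _; rewrite !mul0r.
have [K _ KP] : \forall n \near \oo,
    \sum_(x <- window M) `|f x| * (p x - \sum_(y <- window n) w x y) < 2^-1.
  have := @defect_cvg M (fun x => `|f x|).
  by move=> /(cvgr_lt 0); apply; rewrite invr_gt0.
pose n := maxn K (maxn M n0.+1).
have n_gt0 : (0 < n)%N by rewrite /n; lia.
have Mn : (M <= n)%N by rewrite /n; lia.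
have n0n : (n0 <= n)%N by rewrite /n; lia.
have n2 : (M <= n.*2)%N by lia.
have tS : supported n.*2 (trapezoid n).
  by move=> x /ltnW xn; rewrite trapezoid_support.
exists n.*2, (f \+ trapezoid n); split.
- by move=> x xn; rewrite /= tS// fM ?addr0// (leq_ltn_trans n2).
- by move=> x xn; rewrite /= f1// trapezoid_one ?(leq_trans xn)// natr1.
have /ltW fn : `|energy n.*2 f (trapezoid n)| < 2^-1.
  apply: le_lt_trans (energy_trapezoid_le Mn (leqnn _) n_gt0 fM) (KP n _).
  by rewrite /= leq_maxl.
rewrite energyD energy_sym energyD [energy _ _ (f \+ _)]energy_sym energyD.
rewrite (energy_sym _ (trapezoid n) f) (energy_widen n2)//.
have := trapezoid_energy_le n_gt0; have := ler_normlW fn.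
by move: fE; rewrite -[J.+1%:R]natr1; lra.
Qed.

(** Averaging J.+1 trapezoids divides the energy by (J.+1)^2, against a sum
    that grows linearly. *)
Lemma exists_small_energy (n0 : nat) (eps : R) : 0 < eps -> exists N f,
  [/\ supported N f, forall x, (`|x| <= n0)%N -> f x = 1
    & energy N f f <= eps].
Proof.
move=> eps0; have [J _ JP] : \forall J \near \oo, (B + 1) / J.+1%:R < eps.
  have : (B + 1) / J.+1%:R @[J --> \oo] --> (B + 1) * 0.
    by apply: cvgM; [exact: cvg_cst|exact: cvg_harmonic].
  by rewrite mulr0 => /(cvgr_lt 0); apply.
have [N [f [fN f1 fE]]] := trapezoid_sum n0 J.+1.
have J0 : 0 < J.+1%:R :> R by rewrite ltr0n.
exists N, (J.+1%:R^-1 \*o f); split.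
- by move=> x xN; rewrite /= fN// mulr0.
- by move=> x xn; rewrite /= f1// mulVf// gt_eqF.
rewrite energyZ energy_sym energyZ; apply: le_trans (ltW (JP J _)) => //=.
by rewrite ler_pdivrMl// mulrCA divff ?gt_eqF// mulr1 ler_pdivrMl.
Qed.

End cesaro.

End energy.

(** * Trapezoids have bounded energy *)

Section trapezoid_energy.
Context {R : realType} (w : int -> int -> R) (p : int -> R) (a A : R).
Hypothesis w_ge0 : forall x y, 0 <= w x y.
Hypothesis w_sym : forall x y, w x y = w y x.
Hypothesis w_row_le : forall x N, \sum_(y <- window N) w x y <= p x.
Hypothesis w_row_cvg : forall x,
  \sum_(y <- window N) w x y @[N --> \oo] --> p x.
Hypothesis a01 : 0 < a < 1.
Hypothesis A_ge0 : 0 <= A.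
Hypothesis w_decay : forall x y, x != y -> x != 0 -> y != 0 ->
  w x y <= A * ((`|x|%N%:R `^ a / `|y|%N%:R `^ a +
                 `|y|%N%:R `^ a / `|x|%N%:R `^ a) / (x - y)%:~R ^+ 2).

(** The site 0, where the off-diagonal bound is void, is set apart: there the
    squared difference is bounded by 1 and the row of w at 0 has sum p 0. *)
Lemma trapezoid_pair n x y : (0 < n)%N ->
  (trapezoid n x - trapezoid n y) ^+ 2 * w x y <=
  32 * A * (profile a n.*2.*2 x * profile a n.*2.*2 y) +
  ((x == 0)%:R * w 0 y + (y == 0)%:R * w 0 x).
Proof.
move=> n0; wlog yx : x y / (`|y| <= `|x|)%N.
  move=> h; case/orP: (leq_total `|y|%N `|x|%N) => /h // {}h.
  rewrite -sqrrN opprB w_sym [profile _ _ x * _]mulrC.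
  by rewrite [_%:R * _ + _]addrC.
have s0 : 0 <= 32 * A * (profile a n.*2.*2 x * profile a n.*2.*2 y).
  by rewrite !mulr_ge0// profile_ge0.
have d1 : (trapezoid n x - trapezoid n y) ^+ 2 <= 1 :> R.
  by rewrite -real_normK ?num_real// expr_le1// trapezoid_dist_le1.
have [y0|y0] := eqVneq y 0.
  rewrite y0 mul1r [leRHS]addrA; apply: ler_wpDl.
    by rewrite -y0 addr_ge0// ?mulr_ge0.
  by rewrite w_sym ler_piMl// -y0.
have x0 : x != 0 by lia.
have [->|xy] := eqVneq x y.
  by rewrite subrr expr0n mul0r addr_ge0 ?addr_ge0 ?mulr_ge0 ?profile_ge0.
apply: ler_wpDr; first by rewrite addr_ge0// mulr_ge0.
have [ny|yn] := leqP n.*2 `|y|%N.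
  by rewrite !trapezoid_support ?(leq_trans ny)// subrr expr0n mul0r.
rewrite -real_normK ?num_real//.
apply: le_trans (ler_wpM2l (sqr_ge0 _) (w_decay xy x0 y0)) _.
rewrite mulrCA -[leRHS]mulrA [leRHS]mulrCA ler_wpM2l//.
by apply: profile_dominates; rewrite ?absz_gt0 ?trapezoid_lipschitz
  ?trapezoid_dist_le1 ?normr_ge0// ltnW.
Qed.

Lemma trapezoid_energy_bounded n : (0 < n)%N ->
  energy w p n.*2 (trapezoid n) (trapezoid n) <=
  16 * A * (4 / (1 - a)) ^+ 2 + p 0.
Proof.
move=> n0; apply: energy_le => //.
  by move=> x /ltnW xn; rewrite trapezoid_support.
move=> N; apply: le_trans
  (_ : _ <= \sum_(x <- window N) \sum_(y <- window N)
    (32 * A * (profile a n.*2.*2 x * profile a n.*2.*2 y) +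
     ((x == 0)%:R * w 0 y + (y == 0)%:R * w 0 x))) _.
  by apply: ler_sum => x _; apply: ler_sum => y _; exact: trapezoid_pair.
have m0 : (0 < n.*2.*2)%N by rewrite !double_gt0.
have delta_sum (F : int -> R) : \sum_(x <- window N) (x == 0)%:R * F x = F 0.
  rewrite (bigD1_seq 0) ?window_uniq ?mem_window//= mul1r big1 ?addr0//.
  by move=> x /negbTE ->; rewrite mul0r.
have profile_sum :
    \sum_(x <- window N) \sum_(y <- window N)
      32 * A * (profile a n.*2.*2 x * profile a n.*2.*2 y) <=
    32 * A * (4 / (1 - a)) ^+ 2.
  under eq_bigr do rewrite -mulr_sumr -mulr_sumr.
  rewrite -mulr_sumr -mulr_suml -expr2 ler_wpM2l ?mulr_ge0//.
  have S0 : 0 <= \sum_(x <- window N) profile a n.*2.*2 x.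
    by apply: sumr_ge0 => x _; exact: profile_ge0.
  have Sle := sum_profile_le a01 N m0.
  by rewrite ler_sqr ?nnegrE// (le_trans S0).
have row_sum : \sum_(x <- window N) \sum_(y <- window N) (x == 0)%:R * w 0 y
    <= p 0.
  by under eq_bigr do rewrite -mulr_sumr; rewrite delta_sum.
have col_sum : \sum_(x <- window N) \sum_(y <- window N) (y == 0)%:R * w 0 x
    <= p 0.
  by rewrite exchange_big.
under eq_bigr do rewrite !big_split/=.
rewrite !big_split /=; move: profile_sum row_sum col_sum.
by move: (\sum_(x <- _) _) (\sum_(x <- _) _) (\sum_(x <- _) _) => u v t; lra.
Qed.

End trapezoid_energy.

(** * Occupation of one or two sites *)

Section determinants.
Context {R : realType}.
Implicit Types (K : int -> int -> R[i]) (g : int -> R[i]).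

Lemma fredholm_det1 K g x : fredholm_det K g [set x] = 1 + (g x - 1) * K x x.
Proof.
rewrite /fredholm_det.
have : perm_eq (finmap.enum_fset (fset_set [set x])) [:: x].
  apply: uniq_perm => [||y]; rewrite ?finmap.fset_uniq//.
  rewrite in_fset_set ?mem_seq1; last exact: finite_set1.
  by apply/idP/eqP => [/set_mem|-> ] //; exact: mem_set.
move=> /perm_small_eq -> //=.
by rewrite det_mx11 !mxE eqxx.
Qed.

Lemma fredholm_det2 K g x y : x != y ->
  fredholm_det K g [set x; y] =
    (1 + (g x - 1) * K x x) * (1 + (g y - 1) * K y y) -
    (g x - 1) * (g y - 1) * (K x y * K y x).
Proof.
move=> xy; rewrite /fredholm_det.
have : perm_eq (finmap.enum_fset (fset_set [set x; y])) [:: x; y].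
  apply: uniq_perm => [||z]; rewrite ?finmap.fset_uniq//=; first by rewrite inE xy.
   rewrite in_fset_set; last exact: finite_set2.
  rewrite !inE; apply/idP/idP => [/set_mem[->|->]|].
  - by rewrite eqxx.
  - by rewrite eqxx orbT.
  - by move=> /orP[/eqP->|/eqP->]; apply: mem_set; [left|right].
move: (finmap.enum_fset _) => s.
case: s => [|u [|v [|? ?]]] /[dup] /perm_size //= _ sxy.
have [[-> ->]|[-> ->]] : (u = x /\ v = y) \/ (u = y /\ v = x).
  have := perm_mem sxy x; have := perm_mem sxy y; rewrite !inE !eqxx orbT /=.
  move: xy; case: (eqVneq y u) => [->|_]; case: (eqVneq x u) => [->|_] /=;
    rewrite ?eqxx//=.
  - by move=> _ _ /eqP; auto.
  - by move=> _ /eqP; auto.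
  - by move=> xy /eqP Ey /eqP Ex; rewrite Ex Ey eqxx in xy.
- by rewrite (expand_det_row _ ord0) !big_ord_recl big_ord0 /cofactor !det_mx11
     !mxE /=; ring.
- by rewrite (expand_det_row _ ord0) !big_ord_recl big_ord0 /cofactor !det_mx11
     !mxE /=; ring.
Qed.
End determinants.

Section one_site.
Context {R : realType}.

Lemma Psi_finite (g : int -> R[i]) (s : seq int) (X : conf R) : uniq s ->
  (forall x, x \notin s -> g x = 1) -> Psi g X = \prod_(x <- s) g x ^+ X x.
Proof.
move=> us g1; rewrite fsbig_seq//; apply/esym/fsbig_widen => // x [_ /= xs].
by rewrite g1 ?expr1n//; exact/negP.
Qed.

Lemma bounded_set1 x : bounded_subset [set x].
Proof. by exists `|x| => _ ->. Qed.

Lemma bounded_set2 x y : bounded_subset [set x; y].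
Proof. by exists (`|x| + `|y|) => _ [->|->]; lia. Qed.

Lemma measurable_occupation (x : int) (A : set nat) :
  measurable ([set X | A (X x)] : set (borel_conf R)).
Proof.
have open_eq k : open ([set X | X x = k] : set (conf R)).
  pose f (z : int) : R := (z == x)%:R.
  (* Being occupied k times is an open condition: the integral of the
     indicator of x is an integer, isolated by the ball of radius 1. *)
  have fE X : conf_integral f X = (X x)%:R.
    rewrite /conf_integral -(@fsbig_widen _ _ _ _ [set x])//; last first.
      by move=> z [_ /= /eqP zx]; rewrite /f (negbTE zx) mul0rn.
    by rewrite fsbig_set1 /f eqxx.
  have -> : [set X : conf R | X x = k] =
      vague_subbase (f, ball (k%:R : R) 1).
    apply/seteqP; split => X /=; rewrite /vague_subbase /= fE.
      by move=> ->; exact: ballxx.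
    rewrite /ball /= ltr_distl => /andP[h1 h2].
    have : (k%:R : R) < (X x).+1%:R by rewrite -natr1; lra.
    have : ((X x)%:R : R) < k.+1%:R by rewrite -natr1; lra.
    rewrite !ltr_nat; lia.
  exists [set vague_subbase (f, ball (k%:R : R) 1)]; last exact: bigcup_set1.
  move=> _ ->; apply: finI_from1; split => /=; last exact: ball_open.
  exists `|x| => z; rewrite /= /f; case: eqVneq => [-> _|_ []//].
  exact: lexx.
rewrite (_ : [set X | _] = \bigcup_(k in A) [set X : conf R | X x = k]).
  apply: bigcup_measurable => k _; apply: sub_sigma_algebra; exact: open_eq.
by apply/seteqP; split => [X AX|X [k Ak /= ->]] //; exists (X x).
Qed.
End one_site.

(** * Second moments of linear statistics *)

Section means.
Context d (T : measurableType d) (R : realType) (P : probability T R).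

(** Integrability is carried along with the value of the mean, so that the
    means of finite linear combinations can be computed by plain algebra. *)
Definition has_mean (f : T -> R) (m : R) : Prop :=
  P.-integrable [set: T] (EFin \o f) /\ ('E_P[f] = m%:E)%E.

Lemma has_mean_cst c : has_mean (fun=> c) c.
Proof.
split; last exact: expectation_cst.
by apply/Lfun1_integrable; exact: Lfun_cst.
Qed.

Lemma has_meanD f g a b : has_mean f a -> has_mean g b ->
  has_mean (fun x => f x + g x) (a + b).
Proof.
move=> [fi fa] [gi gb]; split; first exact: (integrableD measurableT fi gi).
by rewrite (@expectationD _ _ _ _ f g) ?fa ?gb//; exact/Lfun1_integrable.
Qed.

Lemma has_meanZ c f a : has_mean f a -> has_mean (fun x => c * f x) (c * a).
Proof.
move=> [fi fa]; split; first exact: (integrableZl measurableT c fi).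
have -> : (fun x => c * f x) = c \o* f by apply/funext => x /=; rewrite mulrC.
by rewrite expectationZl ?fa//; exact/Lfun1_integrable.
Qed.

Lemma has_mean_sum (I : Type) (s : seq I) (f : I -> T -> R) (m : I -> R) :
  (forall i, has_mean (f i) (m i)) ->
  has_mean (fun x => \sum_(i <- s) f i x) (\sum_(i <- s) m i).
Proof.
move=> fm; elim: s => [|i s IH].
  rewrite big_nil; under eq_fun do rewrite big_nil; exact: has_mean_cst.
rewrite big_cons; under eq_fun do rewrite big_cons; exact: has_meanD.
Qed.

Lemma has_mean_bounded (f : T -> R) (m M : R) :
  measurable_fun setT f -> (forall x, `|f x| <= M) ->
  ('E_P[f] = m%:E)%E -> has_mean f m.
Proof.
move=> mf fM fm; split=> //; apply: measurable_bounded_integrable => //.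
  exact: (le_lt_trans (probability_le1 P measurableT) (ltry 1)).
exists M; split; first exact: num_real.
by move=> x Mx y _; apply: le_trans (fM y) (ltW Mx).
Qed.

(** Markov's inequality. *)
Lemma mean_tail (f : T -> R) (m c : R) (A : set T) :
  has_mean f m -> measurable A -> 0 < c ->
  (forall x, 0 <= f x) -> (forall x, A x -> c <= f x) ->
  (P A <= (c^-1 * m)%:E)%E.
Proof.
move=> [/integrableP[mf _] fm] mA c0 f0 fA; rewrite EFinM lee_pdivlMl//.
rewrite -fm unlock; apply: le_trans
  (_ : _ <= \int[P]_(x in A) (f x)%:E)%E _; last first.
  apply: ge0_subset_integral => //; by move=> x _; rewrite lee_fin.
rewrite -integral_cst//; apply: ge0_le_integral => //.
- by move=> x _; rewrite lee_fin ltW.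
- exact: (measurable_funS measurableT (@subsetT _ A) mf).
Qed.

End means.

Section vacancy.
Context {R : realType}.

(** Vacancies are used rather than occupation numbers: they are bounded, and
    products of them are the functionals Psi g for g vanishing on some sites and
    equal to 1 elsewhere, so that their means are determinants. *)
Definition vacant (x : int) (X : conf R) : R := (X x == 0%N)%:R.

Lemma measurable_vacant (G : set (set (conf R))) x :
  measurable ([set X | X x = 0%N] : set (g_sigma_algebraType G)) ->
  measurable_fun setT (vacant x : g_sigma_algebraType G -> R).
Proof.
move=> mx; rewrite (_ : vacant x = \1_[set X | X x = 0%N]); last first.
  apply/funext => X; rewrite indicE /vacant; congr (_%:R).
  by case: eqP => h; [rewrite mem_set|rewrite memNset].
exact: measurable_indic.
Qed.

Context (P : probability (borel_conf R) R) (K : int -> int -> R[i]).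
Hypothesis K_proj : orthogonal_projection_kernel K.
Hypothesis P_det : determinantal K P.

Let p := density K.
Let w := sqnorm_kernel K.

Let measurable_vacant_borel x : measurable_fun setT (vacant x : borel_conf R -> R).
Proof.
apply: measurable_vacant; exact: (@measurable_occupation _ x [set 0%N]).
Qed.

Lemma has_mean_vacant x : has_mean P (vacant x) (1 - p x).
Proof.
apply: (@has_mean_bounded _ _ _ _ _ _ 1) => //.
  by move=> X; rewrite /vacant; case: (_ == _); rewrite ?normr1 ?normr0.
have g1 z : ~ [set x] z -> (z != x)%:R = 1 :> R[i] by move=> /eqP/negbTE ->.
have [+ _] := P_det (bounded_set1 x) g1.
rewrite fredholm_det1 eqxx sub0r mulN1r (density_real K_proj) /=.
move=> <-; congr ('E_P[_])%E; apply/funext => X.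
rewrite (@Psi_finite _ _ [:: x])//; last first.
  by move=> z; rewrite inE => ->.
by rewrite big_seq1 eqxx expr0n /vacant; case: (_ == _).
Qed.

Lemma has_mean_vacant2 x y : x != y ->
  has_mean P (fun X => vacant x X * vacant y X)
    ((1 - p x) * (1 - p y) - w x y).
Proof.
move=> xy; apply: (@has_mean_bounded _ _ _ _ _ _ 1).
- exact: measurable_funM.
- move=> X; rewrite /vacant.
  by do 2!case: (_ == _); rewrite ?mulr1 ?mulr0 ?normr1 ?normr0.
have g1 z : ~ [set x; y] z -> ((z != x) && (z != y))%:R = 1 :> R[i].
  by move=> /not_orP[/eqP/negbTE -> /eqP/negbTE ->].
have [+ _] := P_det (bounded_set2 x y) g1.
rewrite fredholm_det2// !eqxx andbF sub0r (mul_kernel_sym K_proj).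
rewrite !(density_real K_proj) => E.
transitivity ('E_P[fun X => complex.Re
    (Psi (fun z => ((z != x) && (z != y))%:R) X)])%E.
  congr ('E_P[_])%E; apply/funext => X.
  rewrite (@Psi_finite _ _ [:: x; y])/=; last 2 first.
  - by rewrite inE xy.
  - by move=> z; rewrite !inE negb_or => ->.
  rewrite !big_cons big_nil !eqxx andbF !expr0n /vacant.
  by do 2!case: (_ == _) => /=; ring.
by rewrite E; congr (_%:E); rewrite /p /w /=; ring.
Qed.

(** E z^(X x) = 1 + (z - 1) p x is affine in z, so comparing z = 0, 1/2, 1
    leaves no room for the values X x >= 2, where 1/2 + 1_(X x = 0)/2 - 2^(-X x)
    is at least 1/4. *)
Lemma simple_site x : P [set X | (1 < X x)%N] = 0%E.
Proof.
have mgt : measurable ([set X | (1 < X x)%N] : set (borel_conf R)).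
  exact: (@measurable_occupation _ x [set n | (1 < n)%N]).
pose half (X : borel_conf R) : R := 2^-1 ^+ X x.
have mhalf : measurable_fun setT half.
  move=> _ Y mY; rewrite setTI.
  exact: (@measurable_occupation _ x [set n | Y (2^-1 ^+ n)]).
have half_ge0 X : 0 <= half X by rewrite exprn_ge0// invr_ge0.
have hhalf : has_mean P half (1 - p x / 2).
  apply: (@has_mean_bounded _ _ _ _ _ _ 1) => //.
    move=> X; rewrite ger0_norm//.
    by rewrite exprn_ile1 ?invr_ge0 ?invf_le1// ler1n.
  pose g z : R[i] := if z == x then Complex 2^-1 0 else 1.
  have g1 z : ~ [set x] z -> g z = 1 by rewrite /g => /eqP/negbTE ->.
  have [+ _] := P_det (bounded_set1 x) g1.
  rewrite fredholm_det1 {2}/g eqxx (density_real K_proj) => E.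
  transitivity ('E_P[fun X => complex.Re (Psi g X)])%E.
    congr ('E_P[_])%E; apply/funext => X.
    rewrite (@Psi_finite _ _ [:: x])//; last first.
      by move=> z; rewrite inE /g => /negbTE ->.
    rewrite big_seq1 /g eqxx /half.
    by rewrite -[Complex _ _]/(real_complex _ _) -rmorphXn.
  by rewrite E; congr (_%:E); rewrite /p /=; field.
have hgap := has_meanD (has_mean_cst P 2^-1)
  (has_meanD (has_meanZ 2^-1 (has_mean_vacant x)) (has_meanZ (-1) hhalf)).
have n_ge2 n : (1 < n)%N -> 2^-1 ^+ n <= 4^-1 :> R.
  case: n => [|[|n]] // _; rewrite 2!exprS mulrA.
  have : 2^-1 ^+ n <= 1 :> R by rewrite exprn_ile1 ?invr_ge0 ?invf_le1// ler1n.
  by move=> ?; lra.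
have q0 : 0 < 4^-1 :> R by rewrite invr_gt0.
have := mean_tail hgap mgt q0; rewrite (_ : _ + _ = 0); last by field.
rewrite mulr0 => h; apply/eqP; rewrite eq_le measure_ge0 andbT; apply: h.
- move=> X; rewrite /half /vacant; have := @n_ge2 (X x).
  case: (X x) => [|[|n]] //=; [by rewrite expr0; lra|by rewrite expr1; lra|].
  by move=> /(_ isT); lra.
- move=> X /= X1; rewrite /half /vacant; have := n_ge2 _ X1.
  by case: (X x) X1 => [|n] //= _ ?; lra.
Qed.

(** When X x <= 1 this is p x - X x, minus the centered occupation number. *)
Definition fluctuation (x : int) (X : conf R) : R := vacant x X - (1 - p x).

Lemma has_mean_fluctuation2 x y :
  has_mean P (fun X => fluctuation x X * fluctuation y X) (site_covariance w p x y).
Proof.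
have -> : (fun X => fluctuation x X * fluctuation y X) =
    (fun X => vacant x X * vacant y X + (- (1 - p y) * vacant x X +
      (- (1 - p x) * vacant y X + (1 - p x) * (1 - p y)))).
  by apply/funext => X; rewrite /fluctuation; ring.
have rest := has_meanD (has_meanZ (- (1 - p y)) (has_mean_vacant x))
  (has_meanD (has_meanZ (- (1 - p x)) (has_mean_vacant y))
             (has_mean_cst P ((1 - p x) * (1 - p y)))).
rewrite /site_covariance; have [xy|xy] := eqVneq x y.
  subst y.
  have vv : (fun X => vacant x X * vacant x X) = vacant x.
    by apply/funext => X; rewrite /vacant; case: (_ == _); rewrite ?mulr1 ?mulr0.
  have := has_mean_vacant x; rewrite -{1}vv => hv.
  have wxx : w x x = p x ^+ 2.
    by rewrite /w /sqnorm_kernel sqr_normcE (density_real K_proj) expr0n addr0.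
  rewrite (_ : true%:R * p x - w x x = (1 - p x) + (- (1 - p x) * (1 - p x) +
    (- (1 - p x) * (1 - p x) + (1 - p x) * (1 - p x)))); last first.
    by rewrite wxx mul1r; ring.
  exact: has_meanD hv rest.
rewrite (_ : false%:R * p x - w x y =
  ((1 - p x) * (1 - p y) - w x y) + (- (1 - p y) * (1 - p x) +
  (- (1 - p x) * (1 - p y) + (1 - p x) * (1 - p y)))); last by rewrite mul0r; ring.
exact: has_meanD (has_mean_vacant2 xy) rest.
Qed.

Definition statistic (N : nat) (f : int -> R) (X : conf R) : R :=
  \sum_(x <- window N) f x * fluctuation x X.

Lemma has_mean_statistic2 N f :
  has_mean P (fun X => statistic N f X ^+ 2) (energy w p N f f).
Proof.
have -> : (fun X => statistic N f X ^+ 2) = (fun X =>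
    \sum_(x <- window N) \sum_(y <- window N)
      f x * f y * (fluctuation x X * fluctuation y X)).
  apply/funext => X; rewrite expr2 /statistic mulr_suml; apply: eq_bigr => x _.
  by rewrite mulr_sumr; apply: eq_bigr => y _; ring.
do 2!apply: has_mean_sum => ?.
exact: has_meanZ (has_mean_fluctuation2 _ _).
Qed.

Lemma measurable_statistic (G : set (set (conf R))) (s : seq int) (f : int -> R) :
  (forall x, x \in s ->
    measurable ([set X | X x = 0%N] : set (g_sigma_algebraType G))) ->
  measurable_fun setT
    ((fun X => \sum_(x <- s) f x * fluctuation x X) : g_sigma_algebraType G -> R).
Proof.
move=> ms; elim: s ms => [|x s IH] ms.
  under eq_fun do rewrite big_nil; exact: measurable_cst.
under eq_fun do rewrite big_cons; apply: measurable_funD; last first.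
  by apply: IH => y ys; apply: ms; rewrite inE ys orbT.
apply: measurable_funM; first exact: measurable_cst.
apply: measurable_funB; last exact: measurable_cst.
by apply: measurable_vacant; apply: ms; rewrite mem_head.
Qed.

Lemma statistic_tail N f :
  measurable ([set X | 2^-1 <= `|statistic N f X|] : set (borel_conf R)) /\
  (P [set X | (2^-1 <= `|statistic N f X|)%R] <= (4 * energy w p N f f)%:E)%E.
Proof.
have mS : measurable_fun setT (statistic N f : borel_conf R -> R).
  apply: measurable_statistic => x _.
  exact: (@measurable_occupation _ x [set 0%N]).
have mA : measurable ([set X | 2^-1 <= `|statistic N f X|] : set (borel_conf R)).
  rewrite -[X in measurable X]setTI.
  rewrite (_ : [set X | _] =
    (fun X => `|statistic N f X|) @^-1` `[2^-1, +oo[%classic).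
    by apply: (measurableT_comp _ mS) => //; exact: measurable_normr.
  by apply/seteqP; split => X /=; rewrite in_itv /= andbT.
split=> //.
have q0 : 0 < 4^-1 :> R by rewrite invr_gt0.
have := mean_tail (has_mean_statistic2 N f) mA q0; rewrite invrK; apply.
  by move=> X; exact: sqr_ge0.
move=> X /= h; rewrite -[leRHS]real_normK ?num_real//.
rewrite (_ : 4^-1 = 2^-1 ^+ 2); last by field.
by rewrite ler_sqr ?nnegrE.
Qed.

End vacancy.

(** * Rigidity from functions of small energy *)

Section rigidity.
Context {R : realType}.

Lemma num_particles_seq (s : seq int) (X : conf R) : uniq s ->
  num_particles [set` s] X = (\sum_(x <- s) X x)%N.
Proof. by move=> us; rewrite /num_particles -fsbig_seq. Qed.

Lemma window_sum_restrict (M N : nat) (B : set int) (F : int -> R) :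
  (M <= N)%N -> (forall x, B x -> (`|x| <= M)%N) ->
  \sum_(x <- window N | x \in B) F x = \sum_(x <- window M | x \in B) F x.
Proof.
move=> MN BM; rewrite big_mkcond [RHS]big_mkcond; apply: sum_window_widen => // x.
by case: ifPn => // /set_mem/BM; rewrite ltnNge => ->.
Qed.

Lemma exterior_event (B : set int) x : ~ B x ->
  measurable ([set X | X x = 0%N] :
    set (g_sigma_algebraType (@particle_events R (~` B)))).
Proof.
move=> Bx; apply: sub_sigma_algebra; exists [set x], [set 0%N]; split.
- exact: bounded_set1.
- by move=> _ ->.
- by apply/seteqP; split => X /=; rewrite /num_particles fsbig_set1.
Qed.

Context (P : probability (borel_conf R) R) (K : int -> int -> R[i]).
Hypothesis K_proj : orthogonal_projection_kernel K.
Hypothesis P_det : determinantal K P.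

Let p := density K.
Let w := sqnorm_kernel K.

Lemma multiple_negligible :
  P.-negligible [set X | exists x, (1 < X x)%N].
Proof.
pose F (n : nat) := [set X : borel_conf R | (1 < X n)%N] `|`
                    [set X : borel_conf R | (1 < X (- n%:Z))%N].
apply: (@negligibleS _ _ _ _ (\bigcup_n F n)).
  move=> X [x xX]; exists `|x|%N => //; rewrite /F /=.
  have [x0|x0] : x = `|x|%N%:Z \/ x = - `|x|%N%:Z by lia.
    by left; rewrite -x0.
  by right; rewrite -x0.
apply: negligible_bigcup => n; apply: negligibleU; apply/negligibleP.
- exact: (@measurable_occupation _ _ [set k | (1 < k)%N]).
- exact: simple_site K_proj P_det _.
- exact: (@measurable_occupation _ _ [set k | (1 < k)%N]).
- exact: simple_site K_proj P_det _.
Qed.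

(** On B the function f is 1, so that the interior part of the statistic is a
    constant minus a number of particles. *)
Lemma statistic_split (N n0 : nat) (B : set int) (f : int -> R) (X : conf R) :
  supported N f -> (forall x, (`|x| <= n0)%N -> f x = 1) ->
  (forall x, B x -> (`|x| <= n0)%N) -> (forall x, (X x <= 1)%N) ->
  statistic K N f X =
    \sum_(x <- window N | x \notin B) f x * fluctuation K x X +
    \sum_(x <- window n0 | x \in B) p x - (num_particles B X)%:R.
Proof.
move=> fN f1 Bn0 X1.
(* Otherwise the site n0 would lie outside the support of f. *)
have n0N : (n0 <= N)%N.
  rewrite leqNgt; apply/negP => Nn0; have := f1 n0%:Z (leqnn _).
  by rewrite fN// => /eqP; rewrite eq_sym oner_eq0.
have NB : num_particles B X = (\sum_(x <- window n0 | x \in B) X x)%N.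
  have {1}-> : B = [set` [seq x <- window n0 | x \in B]].
    apply/seteqP; split => x /=; rewrite mem_filter mem_window.
      by move=> Bx; rewrite mem_set//= Bn0.
    by move=> /andP[/set_mem].
  by rewrite num_particles_seq ?filter_uniq ?window_uniq// big_filter.
rewrite NB /statistic (bigID [in B]) /= addrC -addrA; congr (_ + _).
rewrite (window_sum_restrict _ n0N)// natr_sum -sumrB; apply: eq_bigr => x /set_mem Bx.
rewrite f1 ?Bn0// mul1r /fluctuation -/p /vacant.
by have := X1 x; case: (X x) => [|[|n]] //= _; ring.
Qed.

(** The statistics are taken with energies of geometric size, so that almost
    surely they are eventually smaller than 1/2.  The number of particles in B,
    an integer, is then within 1/2 of a quantity read off outside B, which
    determines it; the exceptional configurations form the null set D. *)
Lemma rigidity_of_small_energy :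
  (forall (n0 : nat) (eps : R), 0 < eps -> exists N f,
    [/\ supported N f, forall x, (`|x| <= n0)%N -> f x = 1
      & energy w p N f f <= eps]) ->
  rigid P.
Proof.
move=> small B [r Br]; pose n0 := `|r|%N.
have Bn0 x : B x -> (`|x| <= n0)%N by move=> /Br; rewrite /n0; lia.
have eps_gt0 j : 0 < 4^-1 * (1 / (2 ^ j.+1)%:R) :> R.
  by rewrite mulr_gt0 ?invr_gt0// divr_gt0// ltr0n expn_gt0.
have /choice[Nf NfP] : forall j, exists Nf : nat * (int -> R),
    [/\ supported Nf.1 Nf.2, forall x, (`|x| <= n0)%N -> Nf.2 x = 1
      & energy w p Nf.1 Nf.2 Nf.2 <= 4^-1 * (1 / (2 ^ j.+1)%:R)].
  by move=> j; have [N [f Hf]] := small n0 _ (eps_gt0 j); exists (N, f).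
pose st j := statistic K (Nf j).1 (Nf j).2.
pose A j : set (borel_conf R) := [set X | 2^-1 <= `|st j X|].
have A_tail j : measurable (A j) /\ (P (A j) <= (1 / (2 ^ j.+1)%:R)%:E)%E.
  have [mA PA] := statistic_tail K_proj P_det (Nf j).1 (Nf j).2.
  split=> //; apply: le_trans PA _; rewrite lee_fin.
  by have [_ _] := NfP j; rewrite -ler_pdivrMl ?invr_gt0// invrK.
have limsup_null : P (lim_sup_set A) = 0%E.
  apply: lim_sup_set_cvg0 => [j|]; first by case: (A_tail j).
  apply: le_lt_trans (ltry 1); apply: le_trans (epsilon_trick0 xpredT ler01).
  by apply: lee_nneseries => j _ //; case: (A_tail j).
pose D : set (borel_conf R) :=
  lim_sup_set A `|` [set X | exists x, (1 < X x)%N].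
have D_null : P.-negligible D.
  apply: negligibleU multiple_negligible.
  apply/negligibleP => //; apply: bigcap_measurable => // n _.
  by apply: bigcup_measurable => j _; case: (A_tail j).
(* Off D, st j X = Z j X + S - #_B X with |st j X| < 1/2 for late j, so that
   #_B X = k is the event that E k j holds for all late j. *)
pose S := \sum_(x <- window n0 | x \in B) p x.
pose Z j (X : conf R) : R :=
  \sum_(x <- window (Nf j).1 | x \notin B) (Nf j).2 x * fluctuation K x X.
pose E k j : set (conf R) := [set X | `|Z j X + S - k%:R| < 2^-1].
have mE k j : measurable (E k j : set (g_sigma_algebraType
    (@particle_events R (~` B)))).
  have mZ : measurable_fun setT
      (Z j : g_sigma_algebraType (@particle_events R (~` B)) -> R).
    rewrite /Z; under eq_fun do rewrite -big_filter.
    apply: measurable_statistic => x; rewrite mem_filter => /andP[/negP xB _].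
    by apply: exterior_event => Bx; apply: xB; rewrite inE.
  rewrite -[X in measurable X]setTI.
  rewrite (_ : E k j = (fun X => Z j X + (S - k%:R)) @^-1` ball 0 2^-1).
    by apply: measurable_funD => //; exact: measurable_ball.
  by apply/seteqP; split => X /=; rewrite /E /= /ball /= sub0r normrN addrA.
pose L k := \bigcup_n \bigcap_(j in [set j | (n <= j)%N]) E k j.
have mL k : <<s @particle_events R (~` B) >> (L k).
  change (measurable (L k : set (g_sigma_algebraType
    (@particle_events R (~` B))))).
  apply: bigcup_measurable => n _; apply: bigcap_measurable.
    by exists n => /=.
  by move=> j _.
have numE k X : ~ D X -> L k X <-> @num_particles R B X = k.
  move=> /not_orP[NA NX].
  have X1 x : (X x <= 1)%N.
    by rewrite leqNgt; apply/negP => xX; apply: NX; exists x.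
  have stE j : st j X = Z j X + S - (@num_particles R B X)%:R.
    by have [fN f1 _] := NfP j; exact: statistic_split.
  have [n0' late] : exists n, forall j, (n <= j)%N -> `|st j X| < 2^-1.
    move: NA; rewrite /lim_sup_set => /existsNP[n /not_implyP[_ nA]].
    exists n => j nj; rewrite ltNge; apply/negP => stj; apply: nA.
    by exists j.
  split=> [[m _ mE']|<-].
    pose j := maxn m n0'.
    have := mE' j (leq_maxl _ _); have := late j (leq_maxr _ _).
    rewrite /E /= stE !ltr_norml => /andP[h1 h2] /andP[h3 h4].
    have : (k%:R : R) < (@num_particles R B X).+1%:R by rewrite -natr1; lra.
    have : ((@num_particles R B X)%:R : R) < k.+1%:R by rewrite -natr1; lra.
    by rewrite !ltr_nat; lia.
  by exists n0' => // j /late; rewrite stE.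
move=> _ Y _; rewrite setTI.
rewrite (_ : _ @^-1` Y = \bigcup_(k in Y) (@num_particles R B @^-1` [set k]));
  last first.
  by apply/seteqP; split => [X YX|X [k Yk /= ->]] //; exists (@num_particles R B X).
apply: bigcup_measurable => k _.
(* The completion contains all null sets, in particular the part of the event
   inside D, about which the exterior says nothing. *)
have null_measurable (N : set (conf R)) : P.-negligible N ->
    measurable (N : set (completed_sigma P (~` B))).
  by move=> N0; apply: sub_sigma_algebra; right.
have mLc : measurable (L k : set (completed_sigma P (~` B))).
  by apply: sub_sigma_algebra; left; exact: mL.
rewrite (_ : _ @^-1` _ =
  (L k `\` D) `|` ((@num_particles R B @^-1` [set k]) `&` D)); last first.
  apply/seteqP; split => X /=.
    move=> Xk; have [DX|DX] := pselect (D X); [by right|left].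
    by split => //; apply/(numE k X DX).
  by case=> [[LX /(numE k X)[+ _]]|[]//]; exact.
apply: measurableU; first by apply: measurableD => //; exact: null_measurable.
by apply: null_measurable; apply: negligibleS D_null; exact: subIsetr.
Qed.

End rigidity.

(** * The theorem *)

(** Squaring the hypothesis on the kernel doubles the exponent, which is where
    alpha < 1/2 enters: the profile t^(-2 alpha) has to be summable near 0. *)
Lemma sqnorm_kernel_decay (R : realType) (K : int -> int -> R[i])
    (alpha c : R) (x y : int) :
  0 < alpha -> 0 < c -> x != y -> x != 0 -> y != 0 ->
  normc (K x y) <=
    c * ((`|x%:~R / y%:~R| `^ alpha + `|y%:~R / x%:~R| `^ alpha)
         / `|x%:~R - y%:~R|) ->
  sqnorm_kernel K x y <=
    2 * c ^+ 2 * ((`|x|%N%:R `^ (2 * alpha) / `|y|%N%:R `^ (2 * alpha) +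
                   `|y|%N%:R `^ (2 * alpha) / `|x|%N%:R `^ (2 * alpha))
                  / (x - y)%:~R ^+ 2).
Proof.
move=> al0 c0 xy x0 y0 bound.
have absE z : `|z%:~R| = `|z|%N%:R :> R by rewrite -intr_norm pmulrn; congr (_%:~R).
have sq u v : u != 0 -> v != 0 ->
    (`|u%:~R / v%:~R| `^ alpha) ^+ 2 =
    `|u|%N%:R `^ (2 * alpha) / `|v|%N%:R `^ (2 * alpha) :> R.
  move=> u0 v0; rewrite -powR_mulrn ?powR_ge0// -powRrM [alpha * _]mulrC.
  rewrite normrM normrV ?unitfE ?intr_eq0// !absE powRM// ?invr_ge0//.
  by congr (_ * _); rewrite -powRN -powR_inv1 // -powRrM mulN1r.
have N0 (z : R[i]) : 0 <= normc z by case: z => a b; exact: sqrtr_ge0.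
have := bound; rewrite -ler_sqr ?nnegrE; [|exact: N0|exact: le_trans (N0 _) bound].
rewrite -/(sqnorm_kernel K x y) => /le_trans; apply.
rewrite -(sq x y)// -(sq y x)// -intrB.
move: (_ `^ _) (_ `^ _) => u v; rewrite exprMn expr_div_n real_normK ?num_real//.
rewrite (mulrC 2) -[leRHS]mulrA ler_wpM2l ?sqr_ge0// mulrA ler_wpM2r ?invr_ge0 ?sqr_ge0//.
by rewrite -subr_ge0 (_ : _ - _ = (u - v) ^+ 2) ?sqr_ge0//; ring.
Qed.

Theorem proposition4p1 (R : realType) (Pi : int -> int -> R[i])
    (Pi_proj : orthogonal_projection_kernel Pi)
    (alpha eps : R) (C : R -> R)
    (alpha_gt0 : 0 < alpha) (alpha_lt : alpha < 1 / 2) (eps_gt0 : 0 < eps)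
    (C_gt0 : forall r : R, 0 < r -> 0 < C r)
    (Pi_offdiag : forall r : R, 0 < r ->
       forall x y : int, x != y -> r <= `|x%:~R| -> r <= `|y%:~R| ->
       normc (Pi x y) <=
         C r * ((`|x%:~R / y%:~R| `^ alpha + `|y%:~R / x%:~R| `^ alpha)
                / `|x%:~R - y%:~R|))
    (Pi_decay : forall r : R, 0 < r ->
       forall y : int,
       \sum_(x \in [set x : int | `|x%:~R| <= r]) normc (Pi x y) ^+ 2 <=
         C r / (1 + `|y%:~R| `^ (1 + eps)))
    (P : probability (borel_conf R) R) (P_det : determinantal Pi P) :
  rigid P.
Proof.
have a01 : 0 < 2 * alpha < 1 by apply/andP; split; lra.
have A0 : 0 <= 2 * C 1 ^+ 2 by rewrite mulr_ge0// sqr_ge0.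
have decay x y : x != y -> x != 0 -> y != 0 -> sqnorm_kernel Pi x y <=
    2 * C 1 ^+ 2 * ((`|x|%N%:R `^ (2 * alpha) / `|y|%N%:R `^ (2 * alpha) +
      `|y|%N%:R `^ (2 * alpha) / `|x|%N%:R `^ (2 * alpha)) / (x - y)%:~R ^+ 2).
  have ge1 z : z != 0 -> 1 <= `|z%:~R| :> R.
    by move=> z0; rewrite -intr_norm -[1]/(1%:~R) ler_int; lia.
  move=> xy x0 y0; apply: sqnorm_kernel_decay => //; first exact: C_gt0.
  by apply: Pi_offdiag; rewrite ?ge1.
apply: (rigidity_of_small_energy Pi_proj P_det) => n0 e e0.
apply: (exists_small_energy _ _ _ _ _ n0 e0).
- exact: sqnorm_kernel_ge0.
- exact: sqnorm_kernel_sym.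
- exact: row_sum_le.
- exact: row_sum_cvg.
- move=> n n_gt0.
  apply: (@trapezoid_energy_bounded _ _ _ (2 * alpha) (2 * C 1 ^+ 2)) => //.
  + exact: sqnorm_kernel_ge0.
  + exact: sqnorm_kernel_sym.
  + exact: row_sum_le.
  + exact: row_sum_cvg.
Qed.
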